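(* Let $A\in\mathbf{RM}_6$ be a reciprocal $6\times6$ matrix with associated parameters $\xi_1,\dots,\xi_5\ge0$. Then the Kippenhahn curve $C(A)$ consists of three ellipses exactly one of which is centered at the origin if and only if one of the following conditions holds: (1) $\xi_2=\xi_4=2\xi_1\cos\frac{2\pi}{7},\ \ \xi_3=0,\ \ \xi_5=\xi_1$; (2) $\xi_3=\xi_5=k\xi_1,\ \ \xi_2=0,\ \ \xi_4=(k-1)^2\xi_1$; (3) $\xi_1=\xi_3=k\xi_5,\ \ \xi_2=(k-1)^2\xi_5,\ \ \xi_4=0$; where in (2) and (3) the coefficient $k$ takes one of the values $2\cos\frac{\pi}{7}$, $2\cos\frac{3\pi}{7}$.
   Context: A matrix $A=(a_{ij})\in M_n(\mathbb C)$ is reciprocal, $A\in\mathbf{RM}_n$, if it is tridiagonal with zero main diagonal ($a_{ij}=0$ whenever $|i-j|\neq1$) and $a_{i,i+1}a_{i+1,i}=1$ for $i=1,\dots,n-1$. Its parameters are $\xi_j=\frac14(|a_{j,j+1}|-|a_{j+1,j}|)^2\ge 0$, $j=1,\dots,n-1$. For $A\in M_n(\mathbb C)$ put $\operatorname{Re}A=(A+A^* )/2$, let $\lambda_1(\theta)\ge\dots\ge\lambda_n(\theta)$ be the eigenvalues (with multiplicity) of $\operatorname{Re}(e^{i\theta}A)$, and let $\ell_j(\theta)=e^{-i\theta}(\lambda_j(\theta)+i\mathbb R)$, $\theta\in[0,2\pi)$, $j=1,\dots,n$. The Kippenhahn curve $C(A)$ is the envelope of this family of lines. It is understood via its tangent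 lines: $C(A)$ consists of given ellipses if, for every $\theta$, the multiset of lines $\ell_1(\theta),\dots,\ell_n(\theta)$ is the multiset union of the pairs of tangent lines of these ellipses parallel to $e^{-i\theta}i\mathbb R$. Ellipses are allowed to degenerate: an ellipse with minor axis of length zero is the pair of its foci (its ''tangent lines'' being the lines through one of the foci), and its center is the midpoint of the foci. *)

(* Defs.v *)
(* MathComp world, with MathComp-Analysis for cos, sin and pi on an arbitrary
   R : realType; the complex numbers are R[i]. *)
From HB Require Import structures.
From mathcomp Require Import all_boot all_order all_algebra.
From mathcomp Require Import all_classical all_reals all_analysis.
From mathcomp Require Import complex.

Set Implicit Arguments.
Unset Strict Implicit.
Unset Printing Implicit Defensive.

Import Order.TTheory GRing.Theory Num.Theory.

Local Open Scope classical_set_scope.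
Local Open Scope ring_scope.
Local Open Scope complex_scope.
Local Open Scope sesquilinear_scope.

Definition cabs (R : realType) (z : R[i]) : R := ComplexField.Normc.normc z.

Definition expi (R : realType) (theta : R) : R[i] := cos theta +i* sin theta.

Definition reciprocal (R : realType) (n : nat) (A : 'M[R[i]]_n) : Prop :=
  (forall i j : 'I_n,
      ~ (j = i.+1 :> nat \/ i = j.+1 :> nat) -> A i j = 0) /\
  (forall i j : 'I_n, j = i.+1 :> nat -> A i j * A j i = 1).

(* The parameter index [j] is 1-based, as are the rows and columns in
   a_{j,j+1} and a_{j+1,j}; matrix indices are 0-based. *)
Definition xi (R : realType) (n : nat) (A : 'M[R[i]]_n.+1) (j : nat) : R :=
  4^-1 * (cabs (A (inord j.-1) (inord j)) - cabs (A (inord j) (inord j.-1))) ^+ 2.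

Definition real_part (R : realType) (n : nat) (A : 'M[R[i]]_n) : 'M[R[i]]_n :=
  2^-1 *: (A + A ^t*).

Definition eigenvalues (R : realType) (n : nat) (H : 'M[R[i]]_n)
    (s : seq R) : Prop :=
  sorted >=%R s /\ char_poly H = \prod_(x <- s) ('X - (x%:C)%:P).

(* e^{-i theta} (lambda + i R) *)
Definition line (R : realType) (theta lambda : R) : set R[i] :=
  [set z | exists t : R, z = expi (- theta) * (lambda +i* t)].

(* [minor_axis] is the full length of the minor axis; [minor_axis E = 0] is the
   degenerate case, in which [E] stands for the pair of its foci. *)
Record ellipse (R : realType) := Ellipse {
  focus1 : R[i];
  focus2 : R[i];
  minor_axis : R;
  minor_axis_ge0 : 0 <= minor_axis
}.

Definition ellipse_center (R : realType) (E : ellipse R) : R[i] :=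
  (focus1 E + focus2 E) / 2.

Definition major_axis (R : realType) (E : ellipse R) : R :=
  Num.sqrt (minor_axis E ^+ 2 + cabs (focus1 E - focus2 E) ^+ 2).

(* Only used for [0 < minor_axis E]; for [minor_axis E = 0] this is the focal
   segment. *)
Definition locus (R : realType) (E : ellipse R) : set R[i] :=
  [set z | cabs (z - focus1 E) + cabs (z - focus2 E) = major_axis E].

(* A straight line is tangent to a nondegenerate ellipse when it meets it in
   exactly one point. *)
Definition tangent (R : realType) (E : ellipse R) (L : set R[i]) : Prop :=
  exists z : R[i], L `&` locus E = [set z].

(* [L] is the pair of tangent lines of [E] parallel to e^{-i theta} i R. For a
   degenerate [E] it is the line through each focus, so that the line through
   both foci counts twice. *)
Definition tangent_pair (R : realType) (E : ellipse R) (theta : R)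
    (L : set R[i] * set R[i]) : Prop :=
  exists lambda mu : R,
    L = (line theta lambda, line theta mu) /\
    (if minor_axis E == 0 then L.1 (focus1 E) /\ L.2 (focus2 E)
     else [/\ L.1 <> L.2, tangent E L.1 & tangent E L.2]).

(* The Kippenhahn curve of [A] consists of the ellipses [E k], [k < m];
   [perm_eq] is equality of multisets of lines. *)
Definition kippenhahn_consists_of (R : realType) (n m : nat)
    (A : 'M[R[i]]_n) (E : 'I_m -> ellipse R) : Prop :=
  forall theta : R, 0 <= theta < 2 * pi ->
    exists (s : seq R) (L : 'I_m -> set R[i] * set R[i]),
      [/\ eigenvalues (real_part (expi theta *: A)) s,
          forall k, tangent_pair (E k) theta (L k)
        & perm_eq [seq line theta x | x <- s]
                  (flatten [seq [:: (L k).1; (L k).2] | k <- enum 'I_m])].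

(* Main.v *)
(* Re(e^{i theta} A) is tridiagonal with zero diagonal, and the products of its
   off-diagonal pairs are xi_j + cos^2 theta, which gives its characteristic
   polynomial. On the other side, the line at signed distances u, v from the foci is
   tangent to an ellipse with minor axis b iff u v = b^2 / 4. So C(A) consists of
   three ellipses iff this polynomial in x is, for every theta, the product of three
   quadratics (x - p)(x - q) - b^2 / 4, where p, q are the projections of the foci.

   Homogenizing with t = tan theta and w = 1 + t^2, the point t = - i, w = 0 shows
   that the foci are the roots of x^6 - 5 x^4 + 6 x^2 - 1 = - h(x) h(- x) with
   h(x) = x^3 - x^2 - 2 x + 1, hence real: they are the numbers 2 cos(j pi / 7).
   If exactly one center is 0, evenness in x forces the factors to be
   x^2 - m - b0 w and x^2 -+ s x + p - b w, with m = nu^2, p = -+ 1 / nu for a root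
   nu of h. Comparing coefficients, {xi_1, xi_3, xi_5} = {a, a, d} with b = - p a and
   b0 = m d, and the remaining equations together with xi_j >= 0 leave the listed
   families. *)
Require Import Defs.
From HB Require Import structures.
From mathcomp Require Import all_boot all_order all_algebra.
From mathcomp Require Import all_classical all_reals all_analysis.
From mathcomp Require Import complex ring lra zify.
Import Order.TTheory GRing.Theory Num.Theory.
Local Open Scope ring_scope.
Local Open Scope complex_scope.
Set Implicit Arguments.
Unset Strict Implicit.
Unset Printing Implicit Defensive.

(** * Polynomial identities from integer values, and the roots of the cubic [heptic] *)

(** The positive integers are more roots than the degree allows. Starting at 1 suits identities
    known only for [1 <= w], as in [cubic_eq]. *)
Lemma poly_eq0_nat (R : numDomainType) (p : {poly R}) :
  (forall n : nat, p.[n.+1%:R] = 0) -> p = 0.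
Proof.
move=> h; apply/eqP; case: (eqVneq p 0) => // p0.
have := @max_poly_roots _ p [seq n.+1%:R | n <- iota 0 (size p)] p0.
rewrite size_map size_iota ltnn; apply => //.
  by apply/allP => x /mapP[n _ ->]; rewrite /root h.
by rewrite map_inj_uniq ?iota_uniq// => m n /(mulrIn (oner_neq0 R)) [].
Qed.

Lemma horner_rec_eq0 (R : numDomainType) (s : seq R) :
  (forall n : nat, horner_rec s n.+1%:R = 0) -> forall i, s`_i = 0.
Proof.
move=> h i; rewrite -coef_Poly (@poly_eq0_nat _ (Poly s)) ?coef0 // => n.
by rewrite horner_Poly.
Qed.

(* Its roots are [2 cos (pi / 7)], [2 cos (3 pi / 7)] and [- 2 cos (2 pi / 7)]. *)
Definition heptic (R : pzRingType) (x : R) : R := x ^+ 3 - x ^+ 2 - 2 * x + 1.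

(** The map x -> 2 - x^2 sends roots of [heptic] to roots, and the three roots sum to 1, which gives
    the last one. The product of the linear factors is [heptic x] modulo [heptic k]. *)
Lemma heptic_roots (R : idomainType) (k x : R) : heptic k = 0 -> heptic x = 0 ->
  [\/ x = k, x = 2 - k ^+ 2 | x = k ^+ 2 - k - 1].
Proof.
rewrite /heptic => hk hx.
have : (x - k) * (x - (2 - k ^+ 2)) * (x - (k ^+ 2 - k - 1)) = 0.
  have -> : (x - k) * (x - (2 - k ^+ 2)) * (x - (k ^+ 2 - k - 1)) =
    (x ^+ 3 - x ^+ 2 - 2 * x + 1) +
    (k ^+ 3 - k ^+ 2 - 2 * k + 1) * (k ^+ 2 - k * x - 1) by ring.
  by rewrite hk hx mul0r addr0.
move=> /eqP; rewrite !mulf_eq0 => /orP[/orP[]|]; rewrite subr_eq0 => /eqP ->.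
- by constructor 1.
- by constructor 2.
- by constructor 3.
Qed.

(** On x > 1 the cubic is convex; it is -1 at 1, negative at 9/5 and positive at 181/100. *)
Lemma heptic_root_bounds (R : realFieldType) (k : R) : 1 < k -> heptic k = 0 ->
  9 / 5 < k < 181 / 100.
Proof.
rewrite /heptic => k1 hk; apply/andP; split; rewrite ltNge; apply/negP => h; nra.
Qed.

(** * Cosines of multiples of pi / 7 as roots of [heptic] *)

Section cos_pi7.
Variable R : realType.
Implicit Type x : R.

Lemma cosD3 x : cos (x *+ 3) = 4 * cos x ^+ 3 - 3 * cos x.
Proof.
rewrite mulrSr cosD cos_mulr2n sin_mulr2n.
have -> : (cos x * sin x *+ 2) * sin x = (cos x * sin x ^+ 2) *+ 2 by ring.
rewrite sin2cos2; ring.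
Qed.

(** With y = 2 cos x, the sum 2 (cos 4x + cos 3x) equals (y + 2) [heptic y], and [0 < cos x]
    excludes y = -2. *)
Lemma heptic_cos x : 0 < cos x -> cos (x *+ 4) = - cos (x *+ 3) ->
  heptic (2 * cos x) = 0.
Proof.
move=> c0 h.
have h4 : cos (x *+ 4) = 8 * cos x ^+ 4 - 8 * cos x ^+ 2 + 1.
  by rewrite (mulrnA x 2 2) !cos_mulr2n; ring.
rewrite h4 cosD3 in h.
have : (2 * cos x + 2) * heptic (2 * cos x) = 0.
  rewrite /heptic.
  transitivity (2 * (8 * cos x ^+ 4 - 8 * cos x ^+ 2 + 1 +
    (4 * cos x ^+ 3 - 3 * cos x))); first by ring.
  by rewrite h; ring.
by move/eqP; rewrite mulf_eq0 => /orP[/eqP|/eqP //]; lra.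
Qed.

Lemma cos_pi7 : let k := 2 * cos (pi / 7) : R in
  [/\ 9 / 5 < k < 181 / 100, heptic k = 0, 2 * cos (2 * pi / 7) = k ^+ 2 - 2
    & 2 * cos (3 * pi / 7) = k ^+ 2 - k - 1].
Proof.
move=> k; have p0 := pi_gt0 R.
have c0 y : 0 < y < pi / 2 -> 0 < cos y.
  by move=> /andP[y0 y1]; apply: cos_gt0_pihalf; rewrite y1 andbT; lra.
have c1 : 0 < cos (pi / 7 : R) by apply: c0; lra.
have c2 : 0 < cos (2 * pi / 7 : R) by apply: c0; lra.
have c3 : 0 < cos (3 * pi / 7 : R) by apply: c0; lra.
have k0 : 0 < k by rewrite /k; lra.
have E2 : 2 * cos (2 * pi / 7) = k ^+ 2 - 2.
  have -> : 2 * pi / 7 = pi / 7 *+ 2 :> R by field.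
  by rewrite cos_mulr2n /k; ring.
have h1 : heptic k = 0.
  apply: heptic_cos => //.
  have -> : pi / 7 *+ 4 = pi - pi / 7 *+ 3 :> R by field.
  by rewrite cosB cospi sinpi; ring.
(* By [E2] and [c2], k^2 > 2. *)
have kg1 : 1 < k by nra.
have h3 : heptic (2 * cos (3 * pi / 7) : R) = 0.
  apply: heptic_cos => //.
  have -> : 3 * pi / 7 *+ 4 = pi - 3 * pi / 7 *+ 3 + pi *+ 2 :> R by field.
  by rewrite cosD2pi cosB cospi sinpi; ring.
split => //; first exact: heptic_root_bounds.
(* Injectivity of [cos] on [0, pi] excludes k, and 2 - k^2 is negative, so the third root
   remains. *)
have [e|e|//] := heptic_roots h1 h3.
- have := @cos_inj R (3 * pi / 7) (pi / 7).
  rewrite !in_itv /= => /(_ _ _ _) H.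
  have : 3 * pi / 7 = pi / 7 :> R by apply: H; [lra|lra|move: e; rewrite /k; lra].
  lra.
- nra.
Qed.

End cos_pi7.

(* The characteristic polynomial of a tridiagonal 6 x 6 matrix with zero diagonal,
   where [xj] is the product of the two off-diagonal entries number [j]. *)
Definition path5_char (R : pzRingType) (x x1 x2 x3 x4 x5 : R) : R :=
  x ^+ 6 - (x1 + x2 + x3 + x4 + x5) * x ^+ 4
  + (x1 * x3 + x1 * x4 + x1 * x5 + x2 * x4 + x2 * x5 + x3 * x5) * x ^+ 2
  - x1 * x3 * x5.

(** * Comparison of coefficients in x and w *)

Section coefficients.
Variable R : realFieldType.
Implicit Types a b c x w : R.

(** The left side is even in x: the coefficient of x^5 gives s2 = - s1, then that of x^3 gives s1 (C
    - B) = 0, and the even ones give the last three equations. *)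
Lemma even_sextic_factors a2 a1 a0 A s1 B s2 C : s1 != 0 ->
  (forall x, x ^+ 6 - a2 * x ^+ 4 + a1 * x ^+ 2 - a0 =
     (x ^+ 2 + A) * (x ^+ 2 - s1 * x + B) * (x ^+ 2 - s2 * x + C)) ->
  [/\ s2 = - s1, C = B, a2 = s1 ^+ 2 - A - 2 * B,
      a1 = B ^+ 2 + A * (2 * B - s1 ^+ 2) & a0 = - (A * B ^+ 2)].
Proof.
move=> s10 h.
pose s := [:: A * B * C + a0; - A * (s1 * C + s2 * B);
  B * C + A * (B + C + s1 * s2) - a1; - (s1 * C + s2 * B) - A * (s1 + s2);
  A + B + C + s1 * s2 + a2; - (s1 + s2)].
have hs i : s`_i = 0.
  apply: horner_rec_eq0 => n; rewrite /s /=; move: n.+1%:R (h n.+1%:R) => x {}h.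
  transitivity ((x ^+ 2 + A) * (x ^+ 2 - s1 * x + B) * (x ^+ 2 - s2 * x + C)
    - (x ^+ 6 - a2 * x ^+ 4 + a1 * x ^+ 2 - a0)); first by ring.
  by rewrite h subrr.
have /= e0 := hs 0%N; have /= e2 := hs 2%N; have /= e3 := hs 3%N.
have /= e4 := hs 4%N; have /= e5 := hs 5%N.
have Es2 : s2 = - s1 by lra.
have EC : C = B.
  have : s1 * (C - B) = 0 by rewrite Es2 in e3; lra.
  by move/eqP; rewrite mulf_eq0 (negPf s10) /= subr_eq0 => /eqP.
by rewrite Es2 EC in e0 e2 e4 *; split=> //; lra.
Qed.

Lemma cubic_eq a0 a1 a2 a3 b0 b1 b2 b3 :
  (forall w, 1 <= w -> a0 + a1 * w + a2 * w ^+ 2 + a3 * w ^+ 3 =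
                       b0 + b1 * w + b2 * w ^+ 2 + b3 * w ^+ 3) ->
  [/\ a0 = b0, a1 = b1, a2 = b2 & a3 = b3].
Proof.
move=> h.
have hs i : [:: a0 - b0; a1 - b1; a2 - b2; a3 - b3]`_i = 0.
  apply: horner_rec_eq0 => n /=; set w : R := n.+1%:R.
  have /h {}h : 1 <= w by rewrite ler1n.
  transitivity ((a0 + a1 * w + a2 * w ^+ 2 + a3 * w ^+ 3) -
    (b0 + b1 * w + b2 * w ^+ 2 + b3 * w ^+ 3)); first by ring.
  by rewrite h subrr.
by split; apply/eqP; rewrite -subr_eq0; apply/eqP;
  [exact: (hs 0%N)|exact: (hs 1%N)|exact: (hs 2%N)|exact: (hs 3%N)].
Qed.

(* The hypotheses compare the coefficients of [w] in
   [(1 + x1 w)(1 + x3 w)(1 + x5 w) = (1 + a w)^2 (1 + d w)]. *)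
Lemma sym3_double a d x1 x3 x5 : x1 + x3 + x5 = d + 2 * a ->
  x1 * x3 + x1 * x5 + x3 * x5 = a ^+ 2 + 2 * a * d ->
  x1 * x3 * x5 = a ^+ 2 * d ->
  [\/ [/\ x1 = a, x3 = a & x5 = d], [/\ x1 = a, x3 = d & x5 = a]
    | [/\ x1 = d, x3 = a & x5 = a]].
Proof.
move=> h1 h2 h3.
have dbl y z : y + z = d + a -> y * z = a * d ->
    y = a /\ z = d \/ y = d /\ z = a.
  move=> s p; have : (y - a) * (y - d) = 0.
    transitivity (y ^+ 2 - (d + a) * y + a * d); first by ring.
    by rewrite -s -p; ring.
  by move/eqP; rewrite mulf_eq0 !subr_eq0 => /orP[]/eqP e; [left|right];
    split => //; lra.
(* By the three relations, a is a root of the cubic with roots x1, x3, x5; [dbl] then splits the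
   remaining pair. *)
have : (x1 - a) * (x3 - a) * (x5 - a) = 0.
  transitivity (x1 * x3 * x5 - a * (x1 * x3 + x1 * x5 + x3 * x5) +
     a ^+ 2 * (x1 + x3 + x5) - a ^+ 3); first by ring.
  by rewrite h1 h2 h3; ring.
move/eqP; rewrite !mulf_eq0 !subr_eq0 => /orP[/orP[]|]/eqP e; subst a.
- have [||[-> ->]|[-> ->]] := dbl x3 x5; [lra|nra| |].
  + by constructor 1.
  + by constructor 2.
- have [||[-> ->]|[-> ->]] := dbl x1 x5; [lra|nra| |].
  + by constructor 1.
  + by constructor 3.
- have [||[-> ->]|[-> ->]] := dbl x1 x3; [lra|nra| |].
  + by constructor 2.
  + by constructor 3.
Qed.

(** Powers of w are compared in the coefficients of x^4, x^2 and 1. The choice of a and d turns p1 -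
    b1 w into p1 (1 + a w) and p0 - b0 w into p0 (1 + d w), the shape treated by [sym3_double]. The
    formula for x1 + x5 is [c11] minus twice [c21]. *)
Lemma path5_char_factors x1 x2 x3 x4 x5 p0 b0 s1 p1 b1 s2 p2 b2 : s1 != 0 ->
  (forall x w, 1 <= w ->
     path5_char x (1 + x1 * w) (1 + x2 * w) (1 + x3 * w) (1 + x4 * w)
       (1 + x5 * w) =
     (x ^+ 2 + (p0 - b0 * w)) * (x ^+ 2 - s1 * x + (p1 - b1 * w))
       * (x ^+ 2 - s2 * x + (p2 - b2 * w))) ->
  exists a d, [/\ b0 = - p0 * d, b1 = - p1 * a, - p0 * p1 ^+ 2 = 1,
    (- p0) ^+ 3 - 5 * p0 ^+ 2 - 6 * p0 - 1 = 0 & [/\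
    [\/ [/\ x1 = a, x3 = a & x5 = d], [/\ x1 = a, x3 = d & x5 = a]
      | [/\ x1 = d, x3 = a & x5 = a]],
    x1 + x2 + x3 + x4 + x5 = b0 + 2 * b1,
    x1 + x5 = b1 * (- 2 * p0 - 2 * p1 - 4) + b0 * (3 + p0)
  & x1 * x3 + x1 * x4 + x1 * x5 + x2 * x4 + x2 * x5 + x3 * x5 =
    b1 ^+ 2 + 2 * b1 * b0]].
Proof.
move=> s10 h.
have E w : 1 <= w -> _ := fun hw => even_sextic_factors s10 (fun x => h x w hw).
have [] := cubic_eq (a0 := 5) (a1 := x1 + x2 + x3 + x4 + x5) (a2 := 0) (a3 := 0)
  (b0 := s1 ^+ 2 - p0 - 2 * p1) (b1 := b0 + 2 * b1) (b2 := 0) (b3 := 0).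
  by move=> w /E[_ _ + _ _]; lra.
move=> c20 c21 _ _.
have [] := cubic_eq (a0 := 6)
  (a1 := 3 * x1 + 2 * x2 + 2 * x3 + 2 * x4 + 3 * x5)
  (a2 := x1 * x3 + x1 * x4 + x1 * x5 + x2 * x4 + x2 * x5 + x3 * x5) (a3 := 0)
  (b0 := p1 ^+ 2 + p0 * (2 * p1 - s1 ^+ 2))
  (b1 := - 2 * p1 * b1 - 2 * p0 * b1 - b0 * (2 * p1 - s1 ^+ 2))
  (b2 := b1 ^+ 2 + 2 * b0 * b1) (b3 := 0).
  by move=> w /E[_ _ _ e _]; move: e; lra.
move=> c10 c11 c12 _.
have [] := cubic_eq (a0 := 1) (a1 := x1 + x3 + x5)
  (a2 := x1 * x3 + x1 * x5 + x3 * x5) (a3 := x1 * x3 * x5)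
  (b0 := - (p0 * p1 ^+ 2)) (b1 := b0 * p1 ^+ 2 + 2 * p0 * p1 * b1)
  (b2 := - p0 * b1 ^+ 2 - 2 * b0 * p1 * b1) (b3 := b0 * b1 ^+ 2).
  by move=> w /E[_ _ _ _ e]; move: e; lra.
move=> c00 c01 c02 c03.
have p0n : p0 != 0 by apply/eqP => e; move: c00; rewrite e; lra.
have p1n : p1 != 0 by apply/eqP => e; move: c00; rewrite e; lra.
have Eb0 : b0 = - p0 * (b0 / - p0) by field.
have Eb1 : b1 = - p1 * (b1 / - p1) by field.
exists (b1 / - p1), (b0 / - p0); move: Eb0 Eb1.
set a := b1 / _; set d := b0 / _ => Eb0 Eb1.
have s12 : s1 ^+ 2 = 5 + p0 + 2 * p1 by lra.
have c00' : p0 * p1 ^+ 2 = - 1 by lra.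
split => //; first by lra.
  (* Eliminating s1^2 leaves p1^2 = p0^2 + 5 p0 + 6; multiplied by p0, the left side becomes -1. *)
  move: c10; rewrite s12 => e.
  have : p0 * (6 - p1 ^+ 2 - p0 * (2 * p1 - (5 + p0 + 2 * p1))) = 0.
    by rewrite [X in X - _ - _]e; ring.
  by lra.
split => //; last by rewrite c12; ring.
- apply: sym3_double.
  + rewrite c01 Eb0 Eb1.
    transitivity (- (p0 * p1 ^+ 2) * (d + 2 * a)); first by ring.
    by rewrite c00'; ring.
  + rewrite c02 Eb0 Eb1.
    transitivity (- (p0 * p1 ^+ 2) * (a ^+ 2 + 2 * a * d)); first by ring.
    by rewrite c00'; ring.
  + rewrite c03 Eb0 Eb1.
    transitivity (- (p0 * p1 ^+ 2) * (a ^+ 2 * d)); first by ring.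
    by rewrite c00'; ring.
- by move: c11; rewrite s12; lra.
Qed.

End coefficients.

(** * Solving for the nonnegative parameters, root by root *)

Section parameters.
Variable R : realFieldType.
Variables k x1 x2 x3 x4 x5 : R.
Hypothesis hk : 9 / 5 < k < 181 / 100.
Hypothesis k_root : heptic k = 0.
Hypotheses (x1_ge0 : 0 <= x1) (x2_ge0 : 0 <= x2) (x3_ge0 : 0 <= x3).
Hypotheses (x4_ge0 : 0 <= x4) (x5_ge0 : 0 <= x5).

(* For [k = 2 cos (pi / 7)], [k ^+ 2 - 2 = 2 cos (2 pi / 7)] and
   [k ^+ 2 - k - 1 = 2 cos (3 pi / 7)]. *)
Definition three_ellipses_cond : Prop :=
  [\/ [/\ x2 = (k ^+ 2 - 2) * x1, x4 = (k ^+ 2 - 2) * x1, x3 = 0 & x5 = x1],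
      exists n : R, (n = k \/ n = k ^+ 2 - k - 1) /\
        [/\ x3 = n * x1, x5 = n * x1, x2 = 0 & x4 = (n - 1) ^+ 2 * x1]
    | exists n : R, (n = k \/ n = k ^+ 2 - k - 1) /\
        [/\ x1 = n * x5, x3 = n * x5, x2 = (n - 1) ^+ 2 * x5 & x4 = 0]].

Lemma three_ellipses_cond0 : x1 = 0 -> x3 = 0 -> x5 = 0 -> x2 + x4 = 0 ->
  three_ellipses_cond.
Proof.
rewrite /three_ellipses_cond => -> -> -> /eqP; rewrite paddr_eq0 // => /andP[/eqP -> /eqP ->].
by constructor 1; rewrite mulr0.
Qed.

Variables a d : R.
Hypothesis had : [\/ [/\ x1 = a, x3 = a & x5 = d], [/\ x1 = a, x3 = d & x5 = a]
  | [/\ x1 = d, x3 = a & x5 = a]].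

(** With a = 0 the last relation reads (m^2 - 3 m + 1) d = 0 or m (3 - m) d = 0, and neither factor
    in m vanishes at a root of the cubic, so d = 0 too. *)
Lemma cond_of_trivial_double_root m : m ^+ 3 - 5 * m ^+ 2 + 6 * m - 1 = 0 ->
  a = 0 -> x1 + x2 + x3 + x4 + x5 = m * d -> x1 + x5 = m * d * (3 - m) ->
  three_ellipses_cond.
Proof.
move=> hm a0 s1 s15.
have quad : (m ^+ 2 - 3 * m + 1) * d = 0 -> d = 0.
  move/eqP; rewrite mulf_eq0 => /orP[/eqP h|/eqP//].
  have m1 : m = 1.
    (* Dividing the cubic by m^2 - 3 m + 1 leaves the remainder 1 - m. *)
    have : (m ^+ 2 - 3 * m + 1) * (m - 2) = 0 by rewrite h mul0r.
    by lra.
  by move: h; rewrite m1; lra.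
have d0 : d = 0.
  have [[]|[]|[]] := had => e1 e3 e5.
  - by apply: quad; nra.
  - have /eqP : m * (3 - m) * d = 0 by nra.
    rewrite !mulf_eq0 -orbA => /or3P[/eqP h|/eqP h|/eqP//].
      by move: hm; rewrite h; lra.
    have m3 : m = 3 by lra.
    by move: hm; rewrite m3; lra.
  - by apply: quad; nra.
have [[]|[]|[]] := had; rewrite a0 d0 => e1 e3 e5;
  by apply: three_ellipses_cond0 => //; move: s1; rewrite d0 mulr0; lra.
Qed.

(* At the root [nu = 2 - k^2], [-1/nu = k - 1] and [nu^2 = 3 + k - k^2];
   the parameters must vanish there by positivity. *)
Lemma cond_of_negative_root : let m := 3 + k - k ^+ 2 in
  x1 + x2 + x3 + x4 + x5 = m * d + 2 * ((k - 1) * a) ->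
  x1 + x5 = (k - 1) * a * (2 * m + 2 * (k - 1) - 4) + m * d * (3 - m) ->
  three_ellipses_cond.
Proof.
move=> m s1 s15; have [/andP[k1 k2]] := hk.
have m1 : 153 / 100 < m < 157 / 100 by rewrite /m; apply/andP; split; nra.
have {m1}[/andP[m1 m2]] := m1.
pose c1 := (k - 1) * (2 * m + 2 * (k - 1) - 4); pose c2 := m * (3 - m).
have [hc1 hc1'] : 55 / 100 < c1 /\ c1 < 61 / 100.
  rewrite /c1; set q := 2 * m + _ - 4.
  have kk : 0 <= (k - 9 / 5) * (181 / 100 - k) by rewrite mulr_ge0 //; lra.
  have kk' := sqr_ge0 (k - 9 / 5).
  have [q1 q2] : 6875 / 10000 < q /\ q < 73 / 100 by rewrite /q /m; split; lra.
  by clearbody q; split; nra.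
have [hc2 hc2'] : 22 / 10 < c2 /\ c2 < 23 / 10.
  by rewrite /c2; clearbody m; split; nra.
have {}s15 : x1 + x5 = c1 * a + c2 * d by rewrite s15 /c1 /c2; ring.
have [a0 d0] : 0 <= a /\ 0 <= d by case: had => -[<- <- <-].
have s24 : 0 <= x2 + x4 by rewrite addr_ge0.
have s24' : x2 + x4 = (m - 1) * d - 2 * (2 - k) * a.
  by case: had => -[e1 e3 e5]; move: s1; rewrite e1 e3 e5; lra.
(* Now x2 + x4 >= 0 gives 2 a <= 3 d, while x1 + x5, being a + d or 2 a, gives 3 a >= 8 d or 29 a >=
   44 d. Both together force a = d = 0. *)
have h1 : (m - 1) * d <= 57 / 100 * d by apply: ler_wpM2r => //; lra.
have h2 : 38 / 100 * a <= 2 * (2 - k) * a by apply: ler_wpM2r => //; lra.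
have h3 : 22 / 10 * d <= c2 * d by apply: ler_wpM2r => //; lra.
have h4 : 55 / 100 * a <= c1 * a by apply: ler_wpM2r => //; lra.
have [ea ed] : a = 0 /\ d = 0.
  by case: had => -[e1 e3 e5]; move: s15; rewrite e1 e5; split; lra.
by case: had; rewrite ea ed => -[e1 e3 e5]; apply: three_ellipses_cond0 => //;
  rewrite s24' ea ed !mulr0 subrr.
Qed.

(** Here u = 1 / n. The case d = x5 leads to the third alternative, d = x1 to its mirror image, the
    second, and d = x3 to the first. *)
Lemma cond_of_positive_root n u : n = k \/ n = k ^+ 2 - k - 1 -> heptic n = 0 ->
  u * n = 1 ->
  x1 + x2 + x3 + x4 + x5 = n ^+ 2 * d + 2 * (u * a) ->
  x1 + x5 = u * a * (2 * n ^+ 2 + 2 * u - 4) + n ^+ 2 * d * (3 - n ^+ 2) ->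
  x1 * x3 + x1 * x4 + x1 * x5 + x2 * x4 + x2 * x5 + x3 * x5 =
    (u * a) ^+ 2 + 2 * (u * a) * (n ^+ 2 * d) ->
  three_ellipses_cond.
Proof.
move=> nk n_root un s1 s15 s2; have [/andP[k1 k2]] := hk.
move: (k_root) (n_root); rewrite /heptic => hk0 hn0.
have n0 : 0 < n by case: nk => ->; nra.
have Eu : u = 2 + n - n ^+ 2.
  by apply: (mulIf (negbT (gt_eqF n0))); rewrite un; lra.
have [a0 d0] : 0 <= a /\ 0 <= d by case: had => -[<- <- <-].
have Eu2 : u * (2 * n ^+ 2 + 2 * u - 4) = 2.
  have -> : 2 * n ^+ 2 + 2 * u - 4 = 2 * n by rewrite Eu; ring.
  by rewrite mulrCA un mulr1.
have {}s15 : x1 + x5 = 2 * a + n ^+ 2 * d * (3 - n ^+ 2).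
  by rewrite s15 -[in RHS]Eu2; ring.
(* When x1 + x5 = a + d, this identity turns [s15] into a = n d. *)
have E2 : n ^+ 4 - 3 * n ^+ 2 + 1 = n.
  have -> : n ^+ 4 - 3 * n ^+ 2 + 1 =
    (n + 1) * (n ^+ 3 - n ^+ 2 - 2 * n + 1) + n by ring.
  by rewrite hn0; ring.
(* y, z stand for x2, x4 or, mirrored, for x4, x2. The quadratic relation gives z = 0 or z = n (n -
   1) d with y = (1 - n) d; since y and z are nonnegative, the latter forces d = 0, hence again z =
   0. *)
have tail y z : 0 <= y -> 0 <= z -> a = n * d -> y + z = (n - 1) ^+ 2 * d ->
    a ^+ 2 + 2 * a * d + a * z + y * d + y * z = d ^+ 2 + 2 * d * (n ^+ 2 * d) ->
    y = (n - 1) ^+ 2 * d /\ z = 0.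
  move=> y0 z0 ea yz e.
  suff z_eq0 : z = 0 by split => //; lra.
  have Ey : y = (n - 1) ^+ 2 * d - z by lra.
  have /eqP : z * (n * (n - 1) * d - z) = 0 by move: e; rewrite ea Ey; lra.
  rewrite mulf_eq0 => /orP[/eqP //|]; rewrite subr_eq0 => /eqP Ez.
  have {}Ey : y = (1 - n) * d by rewrite Ey -Ez; ring.
  case: nk => En.
  - have n1 : 4 / 5 < n - 1 by lra.
    have d_eq0 : d = 0 by nra.
    by rewrite -Ez d_eq0; ring.
  - have n1 : n < 1 by nra.
    have d_eq0 : d = 0.
      apply/eqP; rewrite eq_le d0 andbT leNgt; apply/negP => dpos.
      have : 0 < n * ((1 - n) * d).
        by rewrite !mulr_gt0 // subr_gt0.
      by lra.
    by rewrite -Ez d_eq0; ring.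
case: had => -[e1 e3 e5]; rewrite e1 e3 e5 in s1 s15 s2.
- have ea : a = n * d by rewrite -[in RHS]E2; lra.
  have ua : u * a = d by rewrite ea mulrA un mul1r.
  have [] := tail x2 x4 => //.
  + by move: s1; rewrite ua ea; lra.
  + by move: s2; rewrite ua; lra.
  move=> e2 e4; constructor 3; exists n; split => //; split => //;
  by rewrite ?e1 ?e3 e5.
(* Here x1 + x5 = 2 a, so [s15] leaves n^2 (3 - n^2) d = 0, and n^2 = 3 contradicts
   [heptic n = 0]. *)
- have d_eq0 : d = 0.
    have /eqP : n ^+ 2 * (3 - n ^+ 2) * d = 0 by lra.
    rewrite !mulf_eq0 -orbA => /or3P[|/eqP h|/eqP//]; first by rewrite (gt_eqF n0).
    have n3 : n ^+ 2 = 3 by lra.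
    have : n ^+ 2 * n - n ^+ 2 - 2 * n + 1 = 0 by rewrite -hn0; ring.
    by rewrite n3 => h'; have n2 : n = 2; [lra|move: n3; rewrite n2; lra].
  rewrite d_eq0 in e3 s1 s15 s2.
  have s24 : 0 <= x2 + x4 by rewrite addr_ge0.
  have hu : x2 + x4 = 2 * (u - 1) * a by lra.
  case: nk => En.
  + have u1 : u < 1 by rewrite Eu; nra.
    have a_eq0 : a = 0 by nra.
    rewrite a_eq0 in e1 e5 hu.
    by apply: three_ellipses_cond0 => //; lra.
  + have Eu' : u - 1 = k ^+ 2 - 2.
      apply: (mulIf (negbT (gt_eqF n0))); rewrite mulrBl un mul1r.
      rewrite En; transitivity (1 - (k ^+ 2 - k - 1) +
        k * (k ^+ 3 - k ^+ 2 - 2 * k + 1)); last by ring.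
      by rewrite hk0; ring.
    (* The sum and product of x2 and x4 are those of a double root, so both equal (u - 1) a. *)
    have : (x2 - x4) ^+ 2 = 0.
      have -> : (x2 - x4) ^+ 2 = (x2 + x4) ^+ 2 - 4 * (x2 * x4) by ring.
      have -> : x2 * x4 = (u * a) ^+ 2 - a ^+ 2 - a * (x2 + x4) by lra.
      by rewrite hu; ring.
    move/eqP; rewrite sqrf_eq0 subr_eq0 => /eqP e24.
    by constructor 1; rewrite -Eu' e1; split => //; lra.
- have ea : a = n * d by rewrite -[in RHS]E2; lra.
  have ua : u * a = d by rewrite ea mulrA un mul1r.
  have [] := tail x4 x2 => //.
  + by move: s1; rewrite ua ea; lra.
  + by move: s2; rewrite ua; lra.
  move=> e4 e2; constructor 2; exists n; split => //; split => //;
  by rewrite ?e3 ?e5 e1.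
Qed.

End parameters.

(** * From a factorization to the three families and back *)

(** Put r = - p0 p1. Then r^2 = - p0 and p1 = 1 / r, so the cubic in - p0 is - [heptic r] times
    [heptic (- r)]. If r > 0, then b1 = - p1 a >= 0 forces a = 0; the negative values are r = 2 -
    k^2 and r = - n with n a positive root of [heptic]. *)
Lemma three_ellipses_cond_of_factors (R : realFieldType)
    (k x1 x2 x3 x4 x5 p0 b0 s1 p1 b1 s2 p2 b2 : R) :
  9 / 5 < k < 181 / 100 -> heptic k = 0 ->
  0 <= x1 -> 0 <= x2 -> 0 <= x3 -> 0 <= x4 -> 0 <= x5 ->
  s1 != 0 -> 0 <= b0 -> 0 <= b1 ->
  (forall x w, 1 <= w ->
     path5_char x (1 + x1 * w) (1 + x2 * w) (1 + x3 * w) (1 + x4 * w)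
       (1 + x5 * w) =
     (x ^+ 2 + (p0 - b0 * w)) * (x ^+ 2 - s1 * x + (p1 - b1 * w))
       * (x ^+ 2 - s2 * x + (p2 - b2 * w))) ->
  three_ellipses_cond k x1 x2 x3 x4 x5.
Proof.
move=> hk k_root x1_ge0 x2_ge0 x3_ge0 x4_ge0 x5_ge0 s1n b0_ge0 b1_ge0.
move=> /(path5_char_factors s1n)[a [d [Eb0 Eb1 hp hm [had hs hs15 he]]]].
pose r := - p0 * p1.
have r2 : r ^+ 2 = - p0.
  rewrite /r; transitivity (- p0 * (- p0 * p1 ^+ 2)); first by ring.
  by rewrite hp mulr1.
have rp : p1 * r = 1 by rewrite /r -hp; ring.
clearbody r; have hr : heptic r = 0 \/ heptic (- r) = 0.
  suff : heptic r * heptic (- r) = 0.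
    by move/eqP; rewrite mulf_eq0 => /orP[]/eqP; [left|right].
  rewrite /heptic; transitivity (- ((r ^+ 2) ^+ 3 - 5 * (r ^+ 2) ^+ 2
    + 6 * r ^+ 2 - 1)); first by ring.
  by rewrite r2 -[RHS]oppr0 -hm; ring.
have a_ge0 : 0 <= a.
  by move: x1_ge0 x3_ge0; case: had => -[-> -> _].
have triv : 0 < p1 -> three_ellipses_cond k x1 x2 x3 x4 x5.
  move=> p1_gt0; have a0 : a = 0.
    apply/eqP; rewrite eq_le a_ge0 andbT -(pmulr_rle0 _ p1_gt0).
    by rewrite -oppr_ge0 -mulNr -Eb1.
  have b10 : b1 = 0 by rewrite Eb1 a0 mulr0.
  apply: (cond_of_trivial_double_root k x2_ge0 x4_ge0 had (m := - p0))
    => //; first by move: hm; lra.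
  - by rewrite hs b10 Eb0; ring.
  - by rewrite hs15 b10 Eb0; ring.
have pos n : n = k \/ n = k ^+ 2 - k - 1 -> 0 < n.
  by move: hk => /andP[k1 k2] [->|->]; nra.
have k2neg : 2 - k ^+ 2 < 0 by move: hk => /andP[k1 k2]; nra.
have p1_gt0 : 0 < r -> 0 < p1 by move=> r0; rewrite -(pmulr_lgt0 _ r0) rp.
have good n : n = k \/ n = k ^+ 2 - k - 1 -> heptic n = 0 -> r = - n ->
    three_ellipses_cond k x1 x2 x3 x4 x5.
  move=> nk n_root rn; have n2 : n ^+ 2 = - p0 by rewrite -r2 rn sqrrN.
  apply: (cond_of_positive_root hk k_root x1_ge0 x2_ge0 x3_ge0 x4_ge0 x5_ge0 had
    (u := - p1) nk n_root) => //.
  - by rewrite mulNr -mulrN -rn.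
  - by rewrite hs Eb0 n2 {1}Eb1.
  - by rewrite hs15 n2 -Eb1 -Eb0; ring.
  - by rewrite he n2 -Eb1 -Eb0; ring.
case: hr => hr; have := heptic_roots k_root hr.
- case=> e; [apply/triv/p1_gt0/pos; by left| |apply/triv/p1_gt0/pos; by right].
  have r2' : r ^+ 2 = 3 + k - k ^+ 2.
    rewrite e; transitivity (3 + k - k ^+ 2 + heptic k * (k + 1)).
      by rewrite /heptic; ring.
    by rewrite k_root mul0r addr0.
  have p1k : p1 = - (k - 1).
    have r0 : r != 0 by apply/eqP => r0; move: rp; rewrite r0 mulr0; lra.
    apply: (mulIf r0); rewrite rp e.
    transitivity (1 + heptic k * 1 - heptic k); first by ring.
    by move: k_root; rewrite /heptic; lra.
  apply: (cond_of_negative_root hk x1_ge0 x2_ge0 x3_ge0 x4_ge0 x5_ge0 had) => //.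
  + by rewrite hs Eb1 Eb0 -r2 r2' p1k; ring.
  + by rewrite hs15 Eb1 Eb0 -r2' r2 p1k; ring.
- have sgn y : - r = y -> r = - y by move=> <-; rewrite opprK.
  case=> e; last 1 first.
  + by apply: (good _ _ _ (sgn _ e)); [right|rewrite -e].
  + by apply: (good _ _ _ (sgn _ e)); [left|].
  + by apply/triv/p1_gt0; rewrite -[r]opprK oppr_gt0 e.
Qed.

(** With c = cos theta, the foci project to c times n, - n, the other two roots of [heptic] and
    their negatives. In the notation of the converse b0 = n^2 d and b1 = a / n, with d = 0 and n =
    k^2 - k - 1 in the first alternative. *)
Lemma path5_char_of_cond (R : realFieldType) (k x1 x2 x3 x4 x5 : R) :
  9 / 5 < k < 181 / 100 -> heptic k = 0 -> 0 <= x1 -> 0 <= x5 ->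
  three_ellipses_cond k x1 x2 x3 x4 x5 ->
  exists n b0 b1, [/\ 0 <= b0, 0 <= b1, n != 1 & forall x c,
    path5_char x (x1 + c ^+ 2) (x2 + c ^+ 2) (x3 + c ^+ 2) (x4 + c ^+ 2)
      (x5 + c ^+ 2) =
    ((x - c * n) * (x - c * - n) - b0) *
    ((x - c * (2 - n ^+ 2)) * (x - c * (n ^+ 2 - n - 1)) - b1) *
    ((x - c * (n ^+ 2 - 2)) * (x - c * (1 + n - n ^+ 2)) - b1)].
Proof.
move=> /andP[k1 k2] hk x1_ge0 x5_ge0.
have roots n : n = k \/ n = k ^+ 2 - k - 1 -> n != 1 /\ n ^+ 3 = n ^+ 2 + 2 * n - 1.
  have k3 : k ^+ 3 = k ^+ 2 + 2 * k - 1 by move: hk; rewrite /heptic; lra.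
  case=> ->; split.
  - by apply/eqP; lra.
  - by [].
  - by apply/eqP => e; nra.
  - by ring: k3.
case=> [[e2 e4 e3 e5]|[n [/roots[n1 n3] [e3 e5 e2 e4]]]|[n [/roots[n1 n3] [e1 e3 e2 e4]]]].
- have [n1 n3] := roots _ (or_intror (erefl (k ^+ 2 - k - 1))).
  set n := k ^+ 2 - k - 1 in n1 n3.
  have k3 : k ^+ 3 = k ^+ 2 + 2 * k - 1 by move: hk; rewrite /heptic; lra.
  have kn : k ^+ 2 - 2 = 1 + n - n ^+ 2 by rewrite /n; ring: k3.
  exists n, 0, ((k ^+ 2 - 1) * x1); split => //.
    by rewrite mulr_ge0 //; nra.
  have -> : k ^+ 2 - 1 = 2 + n - n ^+ 2 by move: kn; lra.
  rewrite /path5_char e2 e3 e4 e5 kn => x c; clearbody n.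
  by ring: n3.
- exists n, (n ^+ 2 * x1), x1; split => //; first by rewrite mulr_ge0 // sqr_ge0.
  by rewrite /path5_char e2 e3 e4 e5 => x c; ring: n3.
- exists n, (n ^+ 2 * x5), x5; split => //; first by rewrite mulr_ge0 // sqr_ge0.
  by rewrite /path5_char e1 e2 e3 e4 => x c; ring: n3.
Qed.

(** * Tangent lines of an ellipse with given foci *)

Section tangents.
Variable R : realType.
Implicit Types (u v s b M t theta lambda mu : R) (z f : R[i]) (E : ellipse R).

(** The coordinate along the unit normal e^{-i theta} of the lines [line theta lambda]. *)
Definition proj theta z : R := complex.Re (expi theta * z).

(* [sqrt P + sqrt Q = M] is rationalized to [4 M^2 P = (M^2 + P - Q)^2], where
   [t] and [- s], [s] are ordinates relative to the midpoint of the foci. *)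
Lemma focal_sum_quadratic u v s b M t : 0 < b -> 0 <= M ->
  M ^+ 2 = b ^+ 2 + (u - v) ^+ 2 + 4 * s ^+ 2 ->
  (Num.sqrt (u ^+ 2 + (t - s) ^+ 2) + Num.sqrt (v ^+ 2 + (t + s) ^+ 2) = M) <->
  4 * M ^+ 2 * (u ^+ 2 + (t - s) ^+ 2) = (M ^+ 2 + u ^+ 2 - v ^+ 2 - 4 * s * t) ^+ 2.
Proof.
move=> b0 M0 hM.
set P := u ^+ 2 + _; set Q := v ^+ 2 + _.
have P0 : 0 <= P by rewrite addr_ge0 ?sqr_ge0.
have Q0 : 0 <= Q by rewrite addr_ge0 ?sqr_ge0.
have -> : M ^+ 2 + u ^+ 2 - v ^+ 2 - 4 * s * t = M ^+ 2 + P - Q by rewrite /P /Q; ring.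
(* Cauchy-Schwarz for (u, t - s) and (v, t + s). It yields |p - q| < M, because [0 < b] makes M
   exceed the distance of the foci. *)
have cs : (u * v + (t - s) * (t + s)) ^+ 2 <= P * Q.
  rewrite -subr_ge0.
  have -> : P * Q - (u * v + (t - s) * (t + s)) ^+ 2 =
    (u * (t + s) - v * (t - s)) ^+ 2 by rewrite /P /Q; ring.
  exact: sqr_ge0.
have PQ : P + Q = (u - v) ^+ 2 + 4 * s ^+ 2 + 2 * (u * v + (t - s) * (t + s)).
  by rewrite /P /Q; ring.
have := sqr_sqrtr P0; have := sqr_sqrtr Q0.
have := sqrtr_ge0 P; have := sqrtr_ge0 Q.
set p : R := Num.sqrt P; set q : R := Num.sqrt Q => q0 p0 eQ eP.
clearbody p q P Q; rewrite -eP -eQ in cs PQ *.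
split=> [<-|e]; first by ring.
have b2 : 0 < b ^+ 2 by rewrite exprn_gt0.
have dist : (p - q) ^+ 2 < M ^+ 2.
  have : u * v + (t - s) * (t + s) <= p * q.
    move: cs; rewrite -exprMn.
    set w := u * v + _ => cs; rewrite leNgt; apply/negP => h.
    by have pq0 : 0 <= p * q; [rewrite mulr_ge0|nra].
  by rewrite hM; lra.
have M1 : 0 < M + p - q.
  rewrite ltNge; apply/negP => h.
  have : M ^+ 2 <= (p - q) ^+ 2 by nra.
  by lra.
have M2 : 0 < M - p + q.
  rewrite ltNge; apply/negP => h.
  have : M ^+ 2 <= (p - q) ^+ 2 by nra.
  by lra.
(* Difference of squares; only the factor M - p - q can vanish. *)
have : (M + p - q) * (M - p + q) * (M + p + q) * (M - p - q) = 0.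
  transitivity ((M ^+ 2 + p ^+ 2 - q ^+ 2) ^+ 2 - 4 * M ^+ 2 * p ^+ 2); first by ring.
  by rewrite e subrr.
move/eqP; rewrite !mulf_eq0 (gt_eqF M1) (gt_eqF M2) /= => /orP[]/eqP; lra.
Qed.

Lemma unique_root_quadratic (K B C : R) : 0 < K ->
  (exists t, forall t', K * t' ^+ 2 + 2 * B * t' + C = 0 <-> t' = t) <->
  B ^+ 2 = K * C.
Proof.
move=> K0; have Kn : K != 0 by rewrite gt_eqF.
split=> [[t ht]|e].
  have h : K * t ^+ 2 + 2 * B * t + C = 0 by apply/ht.
  pose r := 2 * B / K; have Er : 2 * B = r * K by rewrite divfK.
  have /ht e : K * (- r - t) ^+ 2 + 2 * B * (- r - t) + C = 0.
    by rewrite -[RHS]h Er; ring.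
  have {e}er : r = - 2 * t by lra.
  have eB : B = - K * t by move: Er; rewrite er; lra.
  have -> : C = K * t ^+ 2 by move: h; rewrite eB; lra.
  by rewrite eB; ring.
exists (- B / K) => t'.
have E : K * (K * t' ^+ 2 + 2 * B * t' + C) = (K * t' + B) ^+ 2.
  by rewrite mulrDr -e; ring.
split=> [h|->].
  move: E; rewrite h mulr0 => /esym/eqP; rewrite sqrf_eq0 => /eqP h'.
  by apply: (mulfI Kn); rewrite mulrCA mulfV // mulr1; lra.
have -> : C = B ^+ 2 / K by rewrite e mulrAC mulfV // mul1r.
by field.
Qed.

Lemma expiN theta : expi (- theta) * expi theta = 1.
Proof.
rewrite /expi cosN sinN; simpc; apply/eqP; rewrite eq_complex /=.
by rewrite -!expr2 cos2Dsin2 eqxx /= mulrC addrN eqxx.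
Qed.

Lemma lineP theta lambda z : line theta lambda z <-> proj theta z = lambda.
Proof.
split=> [[t ->]|h]; first by rewrite /proj mulrA [_ * expi _]mulrC expiN mul1r.
exists (complex.Im (expi theta * z)).
rewrite -h -[LHS]mul1r -(expiN theta) -mulrA; congr (_ * _).
by rewrite /proj; case: (expi theta * z).
Qed.

Lemma line_inj theta : injective (line theta).
Proof.
move=> lambda mu e.
have /lineP <- : line theta lambda (expi (- theta) * (lambda +i* 0)) by exists 0.
by apply/lineP; rewrite -e; exists 0.
Qed.

Lemma cabs_rot theta z :
  cabs z = Num.sqrt (proj theta z ^+ 2 + complex.Im (expi theta * z) ^+ 2).
Proof.
case: z => a b; rewrite /cabs /proj /=; congr Num.sqrt.
transitivity ((cos theta ^+ 2 + sin theta ^+ 2) * (a ^+ 2 + b ^+ 2)); last by ring.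
by rewrite cos2Dsin2 mul1r.
Qed.

(** With t the ordinate on the line relative to the midpoint of the foci, the points of the ellipse
    are the roots of K t^2 + 2 B t + C, where B^2 - K C = M^2 b^2 (b^2 / 4 - u v). Tangency is a
    double root. *)
Lemma tangent_lineP E theta lambda : 0 < minor_axis E ->
  tangent E (line theta lambda) <->
  (lambda - proj theta (focus1 E)) * (lambda - proj theta (focus2 E)) =
    minor_axis E ^+ 2 / 4.
Proof.
case: E => f1 f2 b b_ge0 /= b0.
pose p1 := proj theta f1; pose p2 := proj theta f2.
pose q1 := complex.Im (expi theta * f1); pose q2 := complex.Im (expi theta * f2).
pose u := lambda - p1; pose v := lambda - p2; pose s := (q1 - q2) / 2.
pose M := major_axis (Ellipse f1 f2 b_ge0).
have hM : M ^+ 2 = b ^+ 2 + (u - v) ^+ 2 + 4 * s ^+ 2.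
  rewrite /M /major_axis /= sqr_sqrtr ?addr_ge0 ?sqr_ge0 //.
  rewrite (cabs_rot theta) sqr_sqrtr ?addr_ge0 ?sqr_ge0 //.
  have -> : proj theta (f1 - f2) = p1 - p2 by rewrite /proj mulrBr raddfB.
  have -> : complex.Im (expi theta * (f1 - f2)) = q1 - q2 by rewrite mulrBr raddfB.
  by rewrite /u /v /s; field.
have M0 : 0 <= M by exact: sqrtr_ge0.
pose K := b ^+ 2 + (u - v) ^+ 2.
have K0 : 0 < K by rewrite ltr_wpDr ?sqr_ge0 // exprn_gt0.
pose B := s * (u ^+ 2 - v ^+ 2).
pose C := M ^+ 2 * (u ^+ 2 + s ^+ 2) - (M ^+ 2 + u ^+ 2 - v ^+ 2) ^+ 2 / 4.
pose pt t := expi (- theta) * (lambda +i* (t + (q1 + q2) / 2)).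
have rot t : expi theta * pt t = lambda +i* (t + (q1 + q2) / 2).
  by rewrite /pt mulrA [_ * expi _]mulrC expiN mul1r.
have ptP t : locus (Ellipse f1 f2 b_ge0) (pt t) <->
    K * t ^+ 2 + 2 * B * t + C = 0.
  rewrite /locus /=.
  have -> : cabs (pt t - f1) = Num.sqrt (u ^+ 2 + (t - s) ^+ 2).
    rewrite (cabs_rot theta) /proj mulrBr rot !raddfB /=.
    by congr (Num.sqrt (_ + _ ^+ 2)); rewrite /s -/q1; field.
  have -> : cabs (pt t - f2) = Num.sqrt (v ^+ 2 + (t + s) ^+ 2).
    rewrite (cabs_rot theta) /proj mulrBr rot !raddfB /=.
    by congr (Num.sqrt (_ + _ ^+ 2)); rewrite /s -/q2; field.
  apply: (iff_trans (focal_sum_quadratic t b0 M0 hM)).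
  have hK : K = M ^+ 2 - 4 * s ^+ 2 by rewrite hM /K; ring.
  by rewrite /B /C hK; split; lra.
have disc : B ^+ 2 - K * C = M ^+ 2 * (b ^+ 2 * (b ^+ 2 / 4 - u * v)).
  by rewrite /B /C /K hM; field.
have M2 : 0 < M ^+ 2.
  by rewrite hM; apply: ltr_wpDr K0; rewrite mulr_ge0 ?sqr_ge0.
have b2 : 0 < b ^+ 2 by rewrite exprn_gt0.
have pt_inj t t' : pt t = pt t' -> t = t'.
  by move=> /(congr1 (fun z => expi theta * z)); rewrite !rot => -[]; lra.
have line_pt z : line theta lambda z <-> exists t, z = pt t.
  split=> [[t ->]|[t ->]]; last by exists (t + (q1 + q2) / 2).
  by exists (t - (q1 + q2) / 2); rewrite /pt subrK.
have -> : tangent (Ellipse f1 f2 b_ge0) (line theta lambda) <->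
    exists t, forall t', K * t' ^+ 2 + 2 * B * t' + C = 0 <-> t' = t.
  split=> [[z hz]|[t ht]].
    have : (line theta lambda `&` locus (Ellipse f1 f2 b_ge0))%classic z.
      by rewrite hz.
    case=> /line_pt[t zE] _; subst z; exists t => t'.
    split=> [/ptP h|->]; last first.
      have : (line theta lambda `&` locus (Ellipse f1 f2 b_ge0))%classic (pt t).
        by rewrite hz.
      by case=> _ /ptP.
    apply: pt_inj.
    have : (line theta lambda `&` locus (Ellipse f1 f2 b_ge0))%classic (pt t').
      by split => //; apply/line_pt; exists t'.
    by rewrite hz.
  exists (pt t); apply/seteqP; split=> [z [/line_pt[t' ->] /ptP /ht ->//]|z -> /=].
  by split; [apply/line_pt; exists t|apply/ptP/ht].
rewrite unique_root_quadratic //.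
split=> h.
  move: disc; rewrite h subrr => /esym/eqP.
  by rewrite mulf_eq0 (gt_eqF M2) mulf_eq0 (gt_eqF b2) subr_eq0 => /eqP ->.
by apply/eqP; rewrite -subr_eq0 disc -h subrr !mulr0.
Qed.

Lemma root_pair_unique p1 p2 c lambda mu : lambda != mu ->
  (lambda - p1) * (lambda - p2) = c -> (mu - p1) * (mu - p2) = c ->
  forall x : R, (x - lambda) * (x - mu) = (x - p1) * (x - p2) - c.
Proof.
move=> ne h1 h2 x.
have : (lambda - mu) * (lambda + mu - p1 - p2) = 0.
  by rewrite -[RHS](subrr c) -{1}h1 -h2; ring.
move/eqP; rewrite mulf_eq0 subr_eq0 (negPf ne) => /eqP e.
have -> : mu = p1 + p2 - lambda by lra.
by rewrite -h1; ring.
Qed.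

Lemma tangent_pair_roots E theta (L : set R[i] * set R[i]) :
  tangent_pair E theta L ->
  exists r : R * R, L = (line theta r.1, line theta r.2) /\
    forall x : R, (x - r.1) * (x - r.2) =
      (x - proj theta (focus1 E)) * (x - proj theta (focus2 E)) -
      minor_axis E ^+ 2 / 4.
Proof.
case=> lambda [mu [->]]; case: ifPn => [/eqP b0 /= [/lineP h1 /lineP h2]|b0].
  by exists (lambda, mu); split => // x /=; rewrite h1 h2 b0 expr0n mul0r subr0.
have b_gt0 : 0 < minor_axis E by rewrite lt_def b0 minor_axis_ge0.
move=> /= [/eqP ne /(tangent_lineP _ _ b_gt0) h1 /(tangent_lineP _ _ b_gt0) h2].
exists (lambda, mu); split => // x /=; apply: root_pair_unique => //.
by apply: contraNneq ne => ->.
Qed.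

Lemma tangent_pair_exists E theta : exists r : R * R,
  tangent_pair E theta (line theta r.1, line theta r.2) /\
    forall x : R, (x - r.1) * (x - r.2) =
      (x - proj theta (focus1 E)) * (x - proj theta (focus2 E)) -
      minor_axis E ^+ 2 / 4.
Proof.
set p1 := proj _ _; set p2 := proj _ _; set b := minor_axis E.
have [b0|b0] := eqVneq b 0.
  exists (p1, p2); split=> [|x]; last by rewrite b0 expr0n mul0r subr0.
  exists p1, p2; split=> //; rewrite -/b b0 eqxx /=.
  by split; apply/lineP.
have b_gt0 : 0 < b by rewrite lt_def b0 minor_axis_ge0.
have D0 : 0 < (p1 - p2) ^+ 2 + b ^+ 2 by rewrite ltr_wpDl ?sqr_ge0 // exprn_gt0.
(* The root of the discriminant of (x - p1)(x - p2) - b^2 / 4; it is positive, so the two tangents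
   differ. *)
pose delta := Num.sqrt ((p1 - p2) ^+ 2 + b ^+ 2).
have d2 : delta ^+ 2 = (p1 - p2) ^+ 2 + b ^+ 2 by rewrite sqr_sqrtr // ltW.
have d0 : 0 < delta by rewrite sqrtr_gt0.
pose r1 := (p1 + p2 + delta) / 2; pose r2 := (p1 + p2 - delta) / 2.
have hr x : (x - r1) * (x - r2) = (x - p1) * (x - p2) - b ^+ 2 / 4.
  have -> : b ^+ 2 = delta ^+ 2 - (p1 - p2) ^+ 2 by rewrite d2; ring.
  by rewrite /r1 /r2; field.
exists (r1, r2); split => //.
exists r1, r2; split => //; rewrite -/b (negPf b0) /=; split.
- by move=> /line_inj; rewrite /r1 /r2; lra.
- apply/tangent_lineP => //; rewrite -/p1 -/p2 -/b.
  by apply/eqP; rewrite -subr_eq0 -hr subrr mul0r.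
- apply/tangent_lineP => //; rewrite -/p1 -/p2 -/b.
  by apply/eqP; rewrite -subr_eq0 -hr subrr mulr0.
Qed.

End tangents.

(** * Determinants of tridiagonal matrices *)

Section tridiagonal.
Variable R : comNzRingType.
Implicit Types d e f : nat -> R.

Definition tridiag n d e f : 'M[R]_n :=
  \matrix_(i, j) if i == j :> nat then d i else if j == i.+1 :> nat then e i
                 else if i == j.+1 :> nat then f j else 0.

(** The continuant recurrence: expansion along the first row, then of the second minor along its
    first column. *)
Lemma det_tridiagS n d e f :
  \det (tridiag n.+2 d e f) =
  d 0%N * \det (tridiag n.+1 (d \o succn) (e \o succn) (f \o succn)) -
  e 0%N * f 0%N * \det (tridiag n (d \o succn \o succn) (e \o succn \o succn)
                               (f \o succn \o succn)).
Proof.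
rewrite (expand_det_row _ ord0) big_ord_recl big_ord_recl big1 ?addr0; last first.
  by move=> i _; rewrite mxE /= mul0r.
rewrite !mxE /= /cofactor /= !expr0 mul1r; congr (_ * _ + _).
  by congr determinant; apply/matrixP => i j; rewrite !mxE /= /bump /= !add1n.
rewrite /bump /= addn0 expr1 mulN1r mulrN -mulrA; congr (- (_ * _)).
rewrite (expand_det_col _ ord0) big_ord_recl big1 ?addr0; last first.
  by move=> i _; rewrite !mxE /= /bump /= mul0r.
rewrite !mxE /= /cofactor /= !expr0 mul1r; congr (_ * _).
by congr determinant; apply/matrixP => i j; rewrite !mxE /= /bump /= !add1n.
Qed.

Lemma det_tridiag6 x e f :
  \det (tridiag 6 (fun=> x) e f) =
  path5_char x (e 0%N * f 0%N) (e 1%N * f 1%N) (e 2%N * f 2%N) (e 3%N * f 3%N)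
    (e 4%N * f 4%N).
Proof.
have det1 d' e' f' : \det (tridiag 1 d' e' f') = d' 0%N.
  by rewrite det_mx11 mxE.
by rewrite !det_tridiagS !det1 !det_mx00 /path5_char /=; ring.
Qed.

End tridiagonal.

Lemma horner_path5_char (R : comNzRingType) (x x1 x2 x3 x4 x5 : R) :
  (path5_char 'X x1%:P x2%:P x3%:P x4%:P x5%:P).[x] = path5_char x x1 x2 x3 x4 x5.
Proof. by rewrite /path5_char !hornerE. Qed.

Lemma rmorph_path5_char (R S : comNzRingType) (h : {rmorphism R -> S})
    (x x1 x2 x3 x4 x5 : R) :
  path5_char (h x) (h x1) (h x2) (h x3) (h x4) (h x5) =
  h (path5_char x x1 x2 x3 x4 x5).
Proof. by rewrite /path5_char; ring. Qed.

(** * The characteristic polynomial of Re(e^{i theta} A) *)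

Section charpoly.
Variable R : realType.
Implicit Types (theta x : R) (u v : R[i]).

Lemma cabs_sqrC u : ((cabs u ^+ 2)%:C = u * u^*)%C.
Proof.
case: u => a b; rewrite /cabs /= sqr_sqrtr ?addr_ge0 ?sqr_ge0 //.
by simpc; apply/eqP; rewrite eq_complex /= !expr2 [b * a]mulrC addNr ?eqxx.
Qed.

(** With z = e^{i theta}, the product is a quarter of |u|^2 + |v|^2 + 2 Re z^2; here |u| |v| = 1 and
    2 Re z^2 = 4 cos^2 theta - 2. *)
Lemma real_part_prod theta u v : u * v = 1 ->
  2^-1 * (expi theta * u + Num.conj (expi theta * v)) *
  (2^-1 * (expi theta * v + Num.conj (expi theta * u))) =
  (4^-1 * (cabs u - cabs v) ^+ 2 + cos theta ^+ 2)%:C.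
Proof.
move=> uv; set z := expi theta.
have zz : z * Num.conj z = 1.
  by rewrite -cabs_sqrC /cabs /z /expi /= sqr_sqrtr cos2Dsin2.
have z2 : z * z + Num.conj (z * z) = (4 * cos theta ^+ 2 - 2)%:C.
  rewrite /z /expi; apply/eqP; rewrite eq_complex /=; apply/andP; split; apply/eqP.
    by rewrite -!expr2 sin2cos2; ring.
  by ring.
have cuv : cabs u * cabs v = 1 by rewrite /cabs -ComplexField.Normc.normcM uv ComplexField.Normc.normc1.
have -> : (cabs u - cabs v) ^+ 2 = cabs u ^+ 2 + cabs v ^+ 2 - 2.
  transitivity (cabs u ^+ 2 + cabs v ^+ 2 - 2 * (cabs u * cabs v)); first by ring.
  by rewrite cuv mulr1.
have cc : Num.conj u * Num.conj v = 1 by rewrite -rmorphM uv rmorph1.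
transitivity (4^-1 * (z * z * (u * v) + z * Num.conj z * (u * Num.conj u) +
  z * Num.conj z * (v * Num.conj v) +
  Num.conj (z * z) * (Num.conj u * Num.conj v))).
  by rewrite !rmorphM; field.
rewrite uv cc zz !mul1r !mulr1 -!cabs_sqrC.
transitivity (4^-1 * ((z * z + Num.conj (z * z)) + (cabs u ^+ 2)%:C +
  (cabs v ^+ 2)%:C)); first by ring.
have -> : 4^-1 = (4^-1)%:C :> R[i] by rewrite fmorphV rmorph_nat.
by rewrite z2 -!rmorphD -rmorphM; congr (_%:C); field.
Qed.

Lemma horner_char_poly_real_part (A : 'M[R[i]]_6) theta x : reciprocal A ->
  (char_poly (real_part (expi theta *: A))).[x%:C] =
  (path5_char x (xi A 1 + cos theta ^+ 2) (xi A 2 + cos theta ^+ 2)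
     (xi A 3 + cos theta ^+ 2) (xi A 4 + cos theta ^+ 2)
     (xi A 5 + cos theta ^+ 2))%:C.
Proof.
move=> [A0 A1]; set H := real_part _.
pose e (i : nat) := - (H (inord i) (inord i.+1))%:P.
pose f (i : nat) := - (H (inord i.+1) (inord i))%:P.
have HE (i j : 'I_6) : H i j = 2^-1 * (expi theta * A i j + Num.conj (expi theta * A j i)).
  by rewrite !mxE.
have H0 (i j : 'I_6) : ~ (j = i.+1 :> nat \/ i = j.+1 :> nat) -> H i j = 0.
  move=> ij; rewrite HE A0 // mulr0 add0r A0 ?mulr0 ?rmorph0 ?mulr0 //.
  by case=> ?; apply: ij; [right|left].
clearbody H.
have -> : char_poly H = \det (tridiag 6 (fun=> 'X) e f).
  congr determinant; apply/matrixP => i j; rewrite !mxE.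
  case: ifPn => [/eqP/val_inj ->|ne].
    by rewrite eqxx mulr1n H0 ?subr0 //; case; lia.
  rewrite -val_eqE /= (negPf ne) mulr0n sub0r.
  case: ifPn => [/eqP ij|ne1].
    by rewrite /e -ij !inord_val.
  case: ifPn => [/eqP ji|ne2].
    by rewrite /f -ji !inord_val.
  by rewrite H0 ?oppr0 //; case; lia.
(* The off-diagonal pair number i, counted from 0, carries the parameter number i + 1. *)
have P i : (i < 5)%N -> e i * f i = ((xi A i.+1 + cos theta ^+ 2)%:C)%:P.
  move=> i5; rewrite /e /f mulrNN -polyCM !HE real_part_prod //.
  by rewrite A1 // !inordK //; lia.
by rewrite det_tridiag6 !P // horner_path5_char -rmorph_path5_char.
Qed.

End charpoly.

(** * The Kippenhahn curve as a factorization of the characteristic polynomial *)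

Section kippenhahn.
Variable R : realType.
Implicit Types (theta x : R) (E : ellipse R).

Definition ellipse_factor E theta x : R :=
  (x - proj theta (focus1 E)) * (x - proj theta (focus2 E)) - minor_axis E ^+ 2 / 4.

(** At fixed theta a line determines its lambda, so multisets of lines correspond to multisets of
    roots, and each tangent pair to the two roots of an [ellipse_factor]. Conversely, such root
    pairs are chosen and sorted. *)
Lemma kippenhahn_factors n m (A : 'M[R[i]]_n) (E : 'I_m -> ellipse R) :
  kippenhahn_consists_of A E <->
  forall theta, 0 <= theta < 2 * pi -> forall x,
    (char_poly (real_part (expi theta *: A))).[x%:C] =
    (\prod_k ellipse_factor (E k) theta x)%:C.
Proof.
pose roots_of (r : 'I_m -> R * R) : seq R :=
  flatten [seq [:: (r k).1; (r k).2] | k <- enum 'I_m].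
have prod_roots theta r x :
    (forall k, (x - (r k).1) * (x - (r k).2) = ellipse_factor (E k) theta x) ->
    (\prod_(y <- roots_of r) ('X - (y%:C)%:P)).[x%:C] =
    (\prod_k ellipse_factor (E k) theta x)%:C.
  move=> hr; rewrite /roots_of big_flatten big_map big_enum /= horner_prod rmorph_prod.
  apply: eq_bigr => k _; rewrite -hr !big_cons big_nil mulr1 hornerM !hornerXsubC.
  by rewrite rmorphM !rmorphB.
have map_roots theta r : [seq line theta y | y <- roots_of r] =
    flatten [seq [:: line theta (r k).1; line theta (r k).2] | k <- enum 'I_m].
  by rewrite /roots_of map_flatten -map_comp.
split=> h theta htheta.
  move=> x; have [s [L [[_ ->] hL hp]]] := h theta htheta.
  have [r hr] := boolp.choice (fun k => tangent_pair_roots (hL k)).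
  rewrite -(prod_roots theta r) => [|k]; last by case: (hr k).
  congr (_.[_]); apply: perm_big; apply: (perm_map_inj (@line_inj _ theta)).
  rewrite map_roots; congr (perm_eq _ (flatten _)): hp.
  by apply: eq_map => k; have [-> _] := hr k.
have [r hr] := boolp.choice (fun k => tangent_pair_exists (E k) theta).
exists (sort >=%R (roots_of r)), (fun k => (line theta (r k).1, line theta (r k).2)).
split=> [|k|]; last 2 first.
- by case: (hr k).
- rewrite -map_roots; apply: perm_map.
  by rewrite perm_sort.
split; first by apply: sort_sorted => x y; exact: le_total.
apply/eqP; rewrite -subr_eq0; apply/eqP/poly_eq0_nat => j.
rewrite hornerD hornerN; have -> : j.+1%:R = (j.+1%:R)%:C :> R[i] by rewrite rmorph_nat.
rewrite h // -(prod_roots theta r) => [|k]; last by case: (hr k).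
apply/eqP; rewrite subr_eq0; apply/eqP.
by congr (_.[_]); apply: perm_big; rewrite perm_sym perm_sort.
Qed.

End kippenhahn.

(** * Location of the foci *)

Section foci.
Variable R : realType.
Variables (x1 x2 x3 x4 x5 : R) (f1 f2 : 'I_3 -> R[i]) (b : 'I_3 -> R).

Let Re (z : R[i]) : R := complex.Re z.
Let Im (z : R[i]) : R := complex.Im z.

(* Divide by [cos theta ^+ 6] with [tan theta = t], so [1 + t ^+ 2 = cos theta ^- 2]. *)
Lemma homogeneous_factors (h : forall theta x, 0 <= theta < 2 * pi ->
    path5_char x (x1 + cos theta ^+ 2) (x2 + cos theta ^+ 2) (x3 + cos theta ^+ 2)
      (x4 + cos theta ^+ 2) (x5 + cos theta ^+ 2) =
    \prod_k ((x - proj theta (f1 k)) * (x - proj theta (f2 k)) - b k))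
  (x t : R) : 0 <= t ->
  path5_char x (1 + x1 * (1 + t ^+ 2)) (1 + x2 * (1 + t ^+ 2))
    (1 + x3 * (1 + t ^+ 2)) (1 + x4 * (1 + t ^+ 2)) (1 + x5 * (1 + t ^+ 2)) =
  \prod_k ((x - (Re (f1 k) - t * Im (f1 k))) * (x - (Re (f2 k) - t * Im (f2 k)))
           - b k * (1 + t ^+ 2)).
Proof.
move=> t0; pose theta := atan t; pose c := cos theta.
have c0 : 0 < c.
  by apply: cos_gt0_pihalf; rewrite atan_gtNpi2 atan_ltpi2.
(* For [0 <= t] the angle atan t lies in [0, pi / 2). *)
have theta0 : 0 <= theta < 2 * pi.
  have : theta < pi / 2 by exact: atan_ltpi2.
  have := pi_gt0 R.
  have : 0 <= theta by rewrite /theta -atan0 le_atan.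
  by move=> -> /=; lra.
have sE : sin theta = t * c.
  by rewrite -[in RHS](atanK t) /tan -/theta -/c divfK // gt_eqF.
have c2 : c ^+ 2 * (1 + t ^+ 2) = 1.
  by rewrite -[RHS](cos2Dsin2 theta) sE -/c; ring.
have := h theta (x * c) theta0; rewrite -/c.
have shift y : y + c ^+ 2 = c ^+ 2 * (1 + y * (1 + t ^+ 2)).
  transitivity (c ^+ 2 + y * (c ^+ 2 * (1 + t ^+ 2))); last by ring.
  by rewrite c2; ring.
rewrite !shift; set y1 := 1 + x1 * _; set y2 := 1 + x2 * _; set y3 := 1 + x3 * _.
set y4 := 1 + x4 * _; set y5 := 1 + x5 * _.
set p := \prod_k _; set q := \prod_k _ => e.
have -> : path5_char x y1 y2 y3 y4 y5 = c ^- 6 * p.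
  rewrite -e /path5_char; field; exact: lt0r_neq0.
have -> : p = c ^+ 6 * q; last by rewrite mulKf // expf_neq0 // gt_eqF.
have -> : c ^+ 6 = \prod_(k < 3) c ^+ 2 by rewrite prodr_const card_ord -exprM.
rewrite -big_split /=; apply: eq_bigr => k _.
have projE z : proj theta z = c * (Re z - t * Im z).
  by case: z => a d; rewrite /proj /Re /Im /= sE -/c; ring.
have bE : b k = c ^+ 2 * (b k * (1 + t ^+ 2)) by rewrite mulrCA c2 mulr1.
by rewrite !projE [in LHS]bE; ring.
Qed.

(* Put [t = - 'i], where [1 + t ^+ 2] vanishes. *)
Lemma complex_foci (h : forall x t : R, 0 <= t ->
  path5_char x (1 + x1 * (1 + t ^+ 2)) (1 + x2 * (1 + t ^+ 2))
    (1 + x3 * (1 + t ^+ 2)) (1 + x4 * (1 + t ^+ 2)) (1 + x5 * (1 + t ^+ 2)) =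
  \prod_k ((x - (Re (f1 k) - t * Im (f1 k))) * (x - (Re (f2 k) - t * Im (f2 k)))
           - b k * (1 + t ^+ 2))) (z : R[i]) :
  path5_char z 1 1 1 1 1 = \prod_k ((z - f1 k) * (z - f2 k)).
Proof.
have natC n : n.+1%:R = (n.+1%:R)%:C :> R[i] by rewrite rmorph_nat.
(* For x a fixed positive integer, both sides are polynomials in t that agree at the positive
   integers, so t may be complex. [Q] repeats the argument in x. *)
have at_nat n : path5_char (n.+1%:R : R[i]) 1 1 1 1 1 =
    \prod_k ((n.+1%:R - f1 k) * (n.+1%:R - f2 k)).
  pose w : {poly R[i]} := 1 + 'X ^+ 2.
  pose l z : {poly R[i]} := (Re z)%:C%:P - 'X * (Im z)%:C%:P.
  set x : R[i] := n.+1%:R.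
  pose P := path5_char x%:P (1 + x1%:C%:P * w) (1 + x2%:C%:P * w)
    (1 + x3%:C%:P * w) (1 + x4%:C%:P * w) (1 + x5%:C%:P * w) -
    \prod_k ((x%:P - l (f1 k)) * (x%:P - l (f2 k)) - (b k)%:C%:P * w).
  have PE a : P.[a] = path5_char x (1 + x1%:C * (1 + a ^+ 2))
      (1 + x2%:C * (1 + a ^+ 2)) (1 + x3%:C * (1 + a ^+ 2))
      (1 + x4%:C * (1 + a ^+ 2)) (1 + x5%:C * (1 + a ^+ 2)) -
    \prod_k ((x - ((Re (f1 k))%:C - a * (Im (f1 k))%:C)) *
             (x - ((Re (f2 k))%:C - a * (Im (f2 k))%:C)) - (b k)%:C * (1 + a ^+ 2)).
    rewrite /P hornerD hornerN horner_prod; congr (_ - _).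
      rewrite -[LHS]/(horner_eval a _) -rmorph_path5_char /= /horner_eval /w.
      by rewrite !hornerE.
    by apply: eq_bigr => k _; rewrite /l /w !hornerE.
  have P0 : P = 0.
    apply: poly_eq0_nat => m; rewrite PE /x !natC.
    have := h n.+1%:R m.+1%:R (ler0n _ _).
    move: (n.+1%:R : R) (m.+1%:R : R) => y t /(congr1 (fun r => r%:C)) e.
    apply/eqP; rewrite subr_eq0; apply/eqP.
    transitivity ((path5_char y (1 + x1 * (1 + t ^+ 2)) (1 + x2 * (1 + t ^+ 2))
      (1 + x3 * (1 + t ^+ 2)) (1 + x4 * (1 + t ^+ 2)) (1 + x5 * (1 + t ^+ 2)))%:C).
      by rewrite /path5_char; ring.
    by rewrite e rmorph_prod; apply: eq_bigr => k _; ring.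
  (* At t = - i, Re f - t Im f is f itself. *)
  have := PE (- 'i); rewrite P0 horner0 sqrrN sqr_i subrr !mulr0 !addr0.
  move=> /esym/eqP; rewrite subr_eq0 => /eqP ->; apply: eq_bigr => k _.
  rewrite mulr0 subr0; congr ((_ - _) * (_ - _)).
    by rewrite mulNr opprK; case: (f1 k) => p q; rewrite /Re /Im /=; simpc.
  by rewrite mulNr opprK; case: (f2 k) => p q; rewrite /Re /Im /=; simpc.
pose Q := path5_char 'X 1 1 1 1 1 - \prod_k (('X - (f1 k)%:P) * ('X - (f2 k)%:P)).
have QE a : Q.[a] = path5_char a 1 1 1 1 1 - \prod_k ((a - f1 k) * (a - f2 k)).
  rewrite /Q hornerD hornerN horner_prod; congr (_ - _).
    rewrite -[LHS]/(horner_eval a _) -rmorph_path5_char /= /horner_eval.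
    by rewrite !hornerE.
  by apply: eq_bigr => k _; rewrite !hornerE.
have Q0 : Q = 0 by apply: poly_eq0_nat => n; rewrite QE at_nat subrr.
by apply/eqP; rewrite -subr_eq0 -QE Q0 horner0.
Qed.

(** The sextic is - [heptic z] times [heptic (- z)], and all roots of [heptic] in R[i] are
    polynomials in the real root k. *)
Lemma real_focus (k : R) (z : R[i]) : heptic k = 0 ->
  path5_char z 1 1 1 1 1 = 0 -> Im z = 0.
Proof.
move=> hk hz.
have hkC : heptic k%:C = 0.
  transitivity ((heptic k)%:C); last by rewrite hk.
  by rewrite /heptic; ring.
have real_root y : heptic y = 0 -> Im y = 0.
  move=> hy; have real_poly (c : R) : y = c%:C -> Im y = 0 by move=> ->.
  case: (heptic_roots hkC hy) => e.
  - exact: (real_poly k).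
  - by apply: (real_poly (2 - k ^+ 2)); rewrite e; ring.
  - by apply: (real_poly (k ^+ 2 - k - 1)); rewrite e; ring.
have : heptic z * heptic (- z) = 0.
  rewrite -oppr0 -hz /heptic /path5_char; ring.
move/eqP; rewrite mulf_eq0 => /orP[/eqP/real_root //|/eqP/real_root h].
by apply/eqP; rewrite -oppr_eq0 -h; case: (z).
Qed.

End foci.

(** * Assembly of both directions *)

(** Moves the factor of the centered ellipse to the front; [i <> k] will make the linear coefficient
    of the next factor nonzero. *)
Lemma prod_ord3 (R : comNzRingType) (k : 'I_3) : exists i j : 'I_3, i <> k /\
  forall F : 'I_3 -> R, \prod_l F l = F k * F i * F j.
Proof.
have prodE (F : 'I_3 -> R) :
    \prod_l F l = F ord0 * F (lift ord0 ord0) * F ord_max.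
  rewrite !big_ord_recl big_ord0 mulr1 mulrA; congr (_ * _ * F _).
  exact: val_inj.
case: k => [[|[|[|//]]] hk].
- have -> : Ordinal hk = ord0 by exact: val_inj.
  by exists (lift ord0 ord0), ord_max; split=> // F; rewrite prodE.
- have -> : Ordinal hk = lift ord0 ord0 by exact: val_inj.
  by exists ord0, ord_max; split=> // F; rewrite prodE; ring.
- have -> : Ordinal hk = ord_max by exact: val_inj.
  by exists ord0, (lift ord0 ord0); split=> // F; rewrite prodE; ring.
Qed.

Lemma xi_ge0 (R : realType) n (A : 'M[R[i]]_n.+1) j : 0 <= xi A j.
Proof. by rewrite mulr_ge0 ?sqr_ge0 // invr_ge0. Qed.

Section main.
Variables (R : realType) (A : 'M[R[i]]_6).
Hypothesis hA : reciprocal A.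

Lemma factors_xi m (E : 'I_m -> ellipse R) :
  kippenhahn_consists_of A E <->
  forall theta, 0 <= theta < 2 * pi -> forall x : R,
    path5_char x (xi A 1 + cos theta ^+ 2) (xi A 2 + cos theta ^+ 2)
      (xi A 3 + cos theta ^+ 2) (xi A 4 + cos theta ^+ 2) (xi A 5 + cos theta ^+ 2) =
    \prod_k ellipse_factor (E k) theta x.
Proof.
split=> [/kippenhahn_factors h theta htheta x|h].
  by have := h theta htheta x; rewrite horner_char_poly_real_part // => -[].
by apply/kippenhahn_factors => theta htheta x; rewrite horner_char_poly_real_part // h.
Qed.

Lemma cond_of_ellipses k (E : 'I_3 -> ellipse R) (c : 'I_3) :
  9 / 5 < k < 181 / 100 -> heptic k = 0 ->
  kippenhahn_consists_of A E -> ellipse_center (E c) = 0 ->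
  (forall l, ellipse_center (E l) = 0 -> l = c) ->
  three_ellipses_cond k (xi A 1) (xi A 2) (xi A 3) (xi A 4) (xi A 5).
Proof.
move=> hk k_root /factors_xi h c0 c_unique.
have h1 theta x (htheta : 0 <= theta < 2 * pi) := h theta htheta x.
have {h h1}hom := homogeneous_factors h1.
have foci := complex_foci hom.
have im0 l : complex.Im (focus1 (E l)) = 0 /\ complex.Im (focus2 (E l)) = 0.
  by split; apply: (real_focus k_root); rewrite foci (bigD1 l) //= subrr
    ?(mul0r, mulr0).
pose p1 l := complex.Re (focus1 (E l)); pose p2 l := complex.Re (focus2 (E l)).
have center l : ellipse_center (E l) = 0 <-> p1 l + p2 l = 0.
  have [] := im0 l; rewrite /ellipse_center /p1 /p2.
  case: (focus1 (E l)) (focus2 (E l)) => a a' [d d'] /= -> ->.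
  have -> : (a +i* 0 + (d +i* 0)) / 2 = ((a + d) / 2)%:C.
    rewrite rmorphM fmorphV rmorph_nat; congr (_ / _).
    by apply/eqP; rewrite eq_complex /= addr0 !eqxx.
  split=> [[]|->]; last by rewrite mul0r.
  by move/eqP; rewrite mulf_eq0 invr_eq0 pnatr_eq0 orbF => /eqP.
have [i [j [ic prodE]]] := prod_ord3 R c.
have si : p1 i + p2 i != 0 by apply/eqP => /center /c_unique.
have b_ge0 l : 0 <= minor_axis (E l) ^+ 2 / 4.
  by rewrite divr_ge0 ?sqr_ge0.
apply: (three_ellipses_cond_of_factors hk k_root (xi_ge0 _ _) (xi_ge0 _ _)
  (xi_ge0 _ _) (xi_ge0 _ _) (xi_ge0 _ _) si (b_ge0 c) (b_ge0 i)
  (p0 := p1 c * p2 c) (p1 := p1 i * p2 i) (s2 := p1 j + p2 j) (p2 := p1 j * p2 j)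
  (b2 := minor_axis (E j) ^+ 2 / 4)) => x w w1.
(* Every w >= 1 is 1 + t^2 with t = sqrt (w - 1). *)
have Ew : 1 + Num.sqrt (w - 1) ^+ 2 = w by rewrite sqr_sqrtr ?subr_ge0 // addrC subrK.
have := hom x _ (sqrtr_ge0 (w - 1)); rewrite Ew => ->; rewrite prodE.
rewrite !(proj1 (im0 _)) !(proj2 (im0 _)) -!/(p1 _) -!/(p2 _).
have -> : p2 c = - p1 c by move/center: c0; lra.
by ring.
Qed.

Lemma ellipses_of_cond k : 9 / 5 < k < 181 / 100 -> heptic k = 0 ->
  three_ellipses_cond k (xi A 1) (xi A 2) (xi A 3) (xi A 4) (xi A 5) ->
  exists E : 'I_3 -> ellipse R, kippenhahn_consists_of A E /\
    (exists! l : 'I_3, ellipse_center (E l) = 0).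
Proof.
move=> hk k_root.
move=> /(path5_char_of_cond hk k_root (xi_ge0 _ _) (xi_ge0 _ _)).
move=> [n [b0 [b1 [b0_ge0 b1_ge0 n1 h]]]].
have minor_ge0 (b : R) : 0 <= 2 * Num.sqrt b by rewrite mulr_ge0 ?sqrtr_ge0.
(* A minor axis 2 sqrt b contributes exactly b to its factor. The centers are 0, (1 - n) / 2 and (n
   - 1) / 2, and n differs from 1. *)
pose E0 := Ellipse n%:C (- n)%:C (minor_ge0 b0).
pose E1 := Ellipse (2 - n ^+ 2)%:C (n ^+ 2 - n - 1)%:C (minor_ge0 b1).
pose E2 := Ellipse (n ^+ 2 - 2)%:C (1 + n - n ^+ 2)%:C (minor_ge0 b1).
pose E (l : 'I_3) := nth E0 [:: E0; E1; E2] l.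
have factorE p q (b : R) theta x : 0 <= b ->
    ellipse_factor (Ellipse p%:C q%:C (minor_ge0 b)) theta x =
    (x - cos theta * p) * (x - cos theta * q) - b.
  move=> b_ge0; rewrite /ellipse_factor /= /proj /= !mulr0 !subr0; congr (_ - _).
  by rewrite exprMn sqr_sqrtr //; field.
have center p q (b : R) : ellipse_center (Ellipse p%:C q%:C (minor_ge0 b)) =
    ((p + q) / 2)%:C.
  by rewrite /ellipse_center /= rmorphM fmorphV rmorph_nat rmorphD.
exists E; split.
  apply/factors_xi => theta _ x; rewrite h !big_ord_recl big_ord0 mulr1 mulrA.
  by rewrite /E /= !factorE.
exists ord0; split; first by rewrite /E /= center subrr mul0r.
move=> [[|[|[|//]]] hl]; rewrite /E /= ?center => -[].
- by move=> _; apply: val_inj.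
- by move=> e; case/eqP: n1; lra.
- by move=> e; case/eqP: n1; lra.
Qed.

End main.

Theorem theorem9 (R : realType) (A : 'M[R[i]]_6) (hA : reciprocal A) :
  (exists E : 'I_3 -> ellipse R,
      kippenhahn_consists_of A E /\ (exists! k : 'I_3, ellipse_center (E k) = 0))
  <->
  [\/ [/\ xi A 2 = 2 * xi A 1 * cos (2 * pi / 7),
          xi A 4 = 2 * xi A 1 * cos (2 * pi / 7),
          xi A 3 = 0
        & xi A 5 = xi A 1],
      exists k : R,
        (k = 2 * cos (pi / 7) \/ k = 2 * cos (3 * pi / 7)) /\
        [/\ xi A 3 = k * xi A 1,
            xi A 5 = k * xi A 1,
            xi A 2 = 0
          & xi A 4 = (k - 1) ^+ 2 * xi A 1]
    | exists k : R,
        (k = 2 * cos (pi / 7) \/ k = 2 * cos (3 * pi / 7)) /\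
        [/\ xi A 1 = k * xi A 5,
            xi A 3 = k * xi A 5,
            xi A 2 = (k - 1) ^+ 2 * xi A 5
          & xi A 4 = 0]].
Proof.
have [hk k_root c2 c3] := cos_pi7 R.
have -> : 2 * xi A 1 * cos (2 * pi / 7) = ((2 * cos (pi / 7)) ^+ 2 - 2) * xi A 1.
  by rewrite -c2; ring.
(* The right side is now [three_ellipses_cond] at k = 2 cos (pi / 7). *)
rewrite c3 -/(three_ellipses_cond _ _ _ _ _ _).
split=> [[E [hE [c [c0 c_unique]]]]|]; last exact: ellipses_of_cond.
by apply: (cond_of_ellipses hA hk k_root hE c0) => l /c_unique.
Qed.
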